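(* Let $G_1$ be a connected graph on $n_1$ vertices, and let $G_2$ be an $r_2$-regular graph with $r_2\ge1$, on $n_2$ vertices and $m_2$ edges, with adjacency matrix $A_{G_2}$ and Laplacian eigenvalues $\mu_1(G_2),\dots,\mu_{n_2}(G_2)$. Let $C=L_{G_2}+r_2I_{n_2}$. Then \begin{align*} Kf(G_1\star G_2)&=n_1(1+n_2+m_2)\Big[\frac{n_1m_2}{3}+\frac{n_1}{3}\Big(\mathrm{tr}(C^{-1}A_{G_2})+r_2\sum_{i=1}^{n_2}\frac{1}{\mu_i(G_2)+r_2}\Big)+3n_1\sum_{i=1}^{n_2}\frac{1}{\mu_i(G_2)+r_2}\\ &\qquad+\frac{m_2+n_2+1}{n_1}Kf(G_1)\Big]-\frac{n_1m_2r_2+n_1n_2(r_2+3)^2}{3r_2}. \end{align*}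
   Context: All graphs are simple and undirected; $L_G=D_G-A_G$ is the Laplacian matrix. The resistance distance between two vertices of a connected graph is the effective resistance between them when every edge is a unit resistor, and the Kirchhoff index $Kf(G)$ of a connected graph is the sum of resistance distances over all unordered pairs of distinct vertices. The corona-edge of the subdivision graph $G_1\star G_2$ is obtained from $G_1$ and $|V(G_1)|$ vertex-disjoint copies of the subdivision graph $S(G_2)$ (the graph obtained from $G_2$ by inserting a new vertex into every edge; the inserted vertices are the subdivision vertices) by joining the $i$-th vertex of $G_1$ to every subdivision vertex of the $i$-th copy. It has $n_1(1+n_2+m_2)$ vertices. *)

(* Defs.v *)
From HB Require Import structures.
From mathcomp Require Import all_boot all_order all_algebra.
Set Implicit Arguments. Unset Strict Implicit. Unset Printing Implicit Defensive.
Import Order.TTheory GRing.Theory Num.Theory.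
Local Open Scope ring_scope.

Definition simple_graph (V : finType) (e : rel V) : Prop :=
  symmetric e /\ irreflexive e.

Definition connected_graph (V : finType) (e : rel V) : Prop :=
  forall u v : V, connect e u v.

Definition deg (V : finType) (e : rel V) (v : V) : nat := #|[set w | e v w]|.

Definition regular (V : finType) (e : rel V) (r : nat) : Prop :=
  forall v : V, deg e v = r.

Definition is_edge (V : finType) (e : rel V) (E : {set V}) : bool :=
  [exists x, exists y, e x y && (E == [set x; y])].

Definition edge_type (V : finType) (e : rel V) : finType :=
  {E : {set V} | is_edge e E}.

Definition num_edges (V : finType) (e : rel V) : nat := #|edge_type e|.

Definition adjmx (R : nzRingType) (V : finType) (e : rel V) : 'M[R]_#|V| :=
  \matrix_(i, j) (e (enum_val i) (enum_val j))%:R.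

Definition lapmx (R : nzRingType) (V : finType) (e : rel V) : 'M[R]_#|V| :=
  \matrix_(i, j) ((i == j)%:R * (deg e (enum_val i))%:R) - adjmx R e.

(* Effective resistance between u and v (unit resistors on edges): the
   potential difference x_u - x_v where x solves L x = e_u - e_v
   (pinvmx gives such a solution whenever one exists; for a connected
   graph the potential difference does not depend on the choice). *)
Definition resistance (R : fieldType) (V : finType) (e : rel V) (u v : V) : R :=
  let b : 'rV[R]_#|V| := delta_mx 0 (enum_rank u) - delta_mx 0 (enum_rank v) in
  let x := b *m pinvmx (lapmx R e) in
  x 0 (enum_rank u) - x 0 (enum_rank v).

Definition kirchhoff (R : fieldType) (V : finType) (e : rel V) : R :=
  \sum_(u : V) \sum_(v : V | (enum_rank u < enum_rank v)%N) resistance R e u v.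

(* Vertices of G1 * G2 (corona-edge of the subdivision graph):
   (i, None)            = vertex i of G1
   (i, Some (inl v))    = vertex v of the i-th copy of S(G2)
   (i, Some (inr E))    = subdivision vertex of edge E in the i-th copy *)
Definition ce_vert (V1 V2 : finType) (e2 : rel V2) : finType :=
  (V1 * option (V2 + edge_type e2))%type.

Definition corona_edge_sub (V1 V2 : finType) (e1 : rel V1) (e2 : rel V2) :
    rel (ce_vert V1 e2) :=
  fun x y =>
    match x.2, y.2 with
    | None, None => e1 x.1 y.1
    | None, Some (inr _) => x.1 == y.1
    | Some (inr _), None => x.1 == y.1
    | Some (inl v), Some (inr E) => (x.1 == y.1) && (v \in val E)
    | Some (inr E), Some (inl v) => (x.1 == y.1) && (v \in val E)
    | _, _ => false
    end.

(* Main.v *)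
(* If X L = 1 - (all-ones column) c for the Laplacian L of a graph G on n
   vertices, then the resistance between u and v is X u u + X v v - X u v - X v u,
   so Kf(G) = n tr X - (sum of the entries of X). Such an X for the corona is
   X ((i, a), (j, b)) = X1 i j + [i = j] M a b, where X1 is one for G1 and M is
   the inverse of the Laplacian block of a single copy of S(G2), extended by 0 at
   the root. A Schur complement expresses M through C^-1, and then its trace and
   the sum of its entries follow from C 1 = r2 1 and 2 m2 = n2 r2. Finally,
   tr C^-1 is read off the logarithmic derivative of the characteristic
   polynomial at - r2. *)
Require Import Defs.
From HB Require Import structures.
From mathcomp Require Import all_boot all_order all_algebra.
From mathcomp Require Import perm ring lra.
Import Order.TTheory GRing.Theory Num.Theory.
Local Open Scope ring_scope.

(** * Traces of shifted inverses from the characteristic polynomial *)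

Lemma deriv_prod (R : comNzRingType) (I : finType) (F : I -> {poly R}) :
  (\prod_i F i)^`() = \sum_i (F i)^`() * \prod_(j | i != j) F j.
Proof.
elim: (index_enum I) (index_enum_uniq I) => [|a s IHs] /=; first by rewrite !big_nil derivC.
case/andP=> a_s /IHs IH; rewrite !big_cons eqxx /= derivM IH mulr_sumr.
congr (_ * _ + _).
  rewrite [RHS]big_seq_cond [LHS]big_seq; apply: eq_bigl => i.
  by case: eqVneq => [<-|]; rewrite ?andbT // (negPf a_s).
apply: eq_big_seq => i i_s; rewrite big_cons.
have -> : i != a by apply: contraNneq a_s => <-.
by rewrite mulrCA.
Qed.

(** Jacobi's formula for X I - A. In the Leibniz expansion the factor of row i has derivative 1 if s
    i = i and 0 otherwise; for fixed i, the products left over for the permutations fixing i add up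
    to the i-th diagonal cofactor. *)
Lemma deriv_char_poly (R : comNzRingType) (n : nat) (A : 'M[R]_n) :
  (char_poly A)^`() = \tr (\adj (char_poly_mx A)).
Proof.
rewrite /char_poly /determinant raddf_sum /=.
under eq_bigr => s _ do
  rewrite -signr_odd -polyC1 -polyCN -polyC_exp mul_polyC derivZ deriv_prod
    scaler_sumr.
rewrite exchange_big /mxtrace; apply: eq_bigr => i _.
rewrite mxE expand_cofactor (bigID (fun s : 'S_n => s i == i)) /=.
rewrite addrC big1 ?add0r => [|s /negPf si]; last first.
  by rewrite !mxE eq_sym si mulr0n sub0r derivN derivC oppr0 mul0r scaler0.
apply: eq_bigr => s /eqP si.
rewrite !mxE si eqxx mulr1n derivB derivX derivC subr0 mul1r.
by rewrite -[in RHS]signr_odd -polyC1 -polyCN -polyC_exp mul_polyC.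
Qed.

(** At X = - c the matrix X I - A becomes - (A + c), so the trace of the inverse of the latter is
    adjugate trace over determinant, that is, the logarithmic derivative of the product of the X -
    mu i at - c. *)
Lemma tr_invmx_shift (F : fieldType) (n : nat) (A : 'M[F]_n) (mu : 'I_n -> F)
    (c : F) :
  char_poly A = \prod_i ('X - (mu i)%:P) -> A + c%:M \in unitmx ->
  \tr (invmx (A + c%:M)) = \sum_i 1 / (mu i + c).
Proof.
move=> chA unitA; pose ev := horner_eval (- c).
have evA : map_mx ev (char_poly_mx A) = - (A + c%:M).
  apply/matrixP=> i j; rewrite !mxE /ev /horner_eval !hornerE hornerMn hornerX.
  by rewrite mulNrn opprD addrC.
have det_ev : (char_poly A).[- c] = \det (- (A + c%:M)).
  by rewrite -evA det_map_mx.
have unitN : - (A + c%:M) \in unitmx by rewrite unitmxE -scaleN1r detZ unitrM -unitmxE unitA unitrX ?unitrN1.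
(* Invertibility of the shift says that - c is no root, which makes the divisions below
   legitimate. *)
have prod_neq0 : \prod_i (- c - mu i) != 0.
  have := unitN; rewrite unitmxE -det_ev chA horner_prod unitfE.
  by under eq_bigr do rewrite !hornerE.
have mu_neq i : - c - mu i != 0.
  by move/prodf_neq0: prod_neq0; apply.
have : \tr (invmx (- (A + c%:M))) = \sum_i (- c - mu i)^-1.
  rewrite /invmx unitN mxtraceZ -det_ev -evA -map_mx_adj trace_map_mx.
  rewrite -deriv_char_poly chA deriv_prod /= horner_evalE horner_sum horner_prod.
  rewrite mulr_sumr; apply: eq_bigr => i _.
  under eq_bigr do rewrite !hornerE.
  rewrite derivB derivX derivC subr0 mul1r horner_prod.
  under [X in _ * X]eq_bigr do rewrite !hornerE.
  rewrite (bigD1 i) //= invfM -mulrA.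
  under eq_bigl do rewrite eq_sym.
  rewrite mulVf ?mulr1 //; apply/prodf_neq0 => j _; exact: mu_neq.
have -> : invmx (- (A + c%:M)) = - invmx (A + c%:M).
  by rewrite -scaleN1r invmxZ ?scaleN1r // invrN1 scaleN1r.
rewrite raddfN /= => /(congr1 -%R); rewrite opprK => ->.
rewrite -sumrN; apply: eq_bigr => i _.
by rewrite -invrN opprB opprK div1r.
Qed.

(** * The Laplacian as an operator on functions: energy, harmonic functions, shifts *)

Lemma sum_ord_rank (R : nmodType) (V : finType) (F : 'I_#|V| -> R) :
  \sum_i F i = \sum_v F (enum_rank v).
Proof. exact/reindex/onW_bij/enum_rank_bij. Qed.

Lemma mulmx_lapmx (R : comNzRingType) (V : finType) (e : rel V) (m : nat)
    (x : 'M[R]_(m, #|V|)) (i : 'I_m) (v : V) : symmetric e ->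
  (x *m lapmx R e) i (enum_rank v) =
    \sum_(w | e v w) (x i (enum_rank v) - x i (enum_rank w)).
Proof.
move=> e_sym; rewrite mxE sum_ord_rank sumrB sumr_const.
under eq_bigr => w _ do
  rewrite !mxE !enum_rankK (inj_eq enum_rank_inj) mulrBr e_sym.
rewrite sumrB; congr (_ - _); last first.
  by rewrite [RHS]big_mkcond; apply: eq_bigr => w _; case: ifP; rewrite ?mulr1 ?mulr0.
rewrite (bigD1 v) //= big1 => [|w /negPf->]; last by rewrite mul0r mulr0.
by rewrite eqxx mul1r addr0 mulr_natr /deg cardsE.
Qed.

Lemma tr_lapmx (R : nzRingType) (V : finType) (e : rel V) : symmetric e ->
  (lapmx R e)^T = lapmx R e.
Proof.
move=> e_sym; apply/matrixP=> i j; rewrite !mxE e_sym eq_sym.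
by case: eqVneq => [->|_] //; rewrite !mul0r.
Qed.

(** The Dirichlet energy: swapping the ends of each ordered edge and adding the two forms of the sum
    turns (f v - f w) f v into a square. *)
Lemma sum_lap_quadratic (R : comNzRingType) (V : finType) (e : rel V)
    (f : V -> R) : symmetric e ->
  (\sum_v (\sum_(w | e v w) (f v - f w)) * f v) *+ 2 =
    \sum_v \sum_(w | e v w) (f v - f w) ^+ 2.
Proof.
move=> e_sym; under eq_bigr do rewrite mulr_suml.
have swap : \sum_v \sum_(w | e v w) (f v - f w) * f v =
    \sum_v \sum_(w | e v w) (f w - f v) * f w.
  rewrite (exchange_big_dep predT) //=; apply: eq_bigr => v _.
  by apply: eq_bigl => w; rewrite e_sym.
rewrite mulr2n {2}swap -big_split /=; apply: eq_bigr => v _.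
by rewrite -big_split /=; apply: eq_bigr => w _; ring.
Qed.

(** A harmonic function has zero energy, so it agrees at the ends of every edge, hence along every
    path. *)
Lemma harmonic_constant (R : realDomainType) (V : finType) (e : rel V)
    (f : V -> R) : symmetric e -> connected_graph e ->
  (forall v, \sum_(w | e v w) (f v - f w) = 0) -> forall v w, f v = f w.
Proof.
move=> e_sym econn fharm.
have edge_eq v w : e v w -> f v = f w.
  move=> evw; have := sum_lap_quadratic R V e f e_sym.
  rewrite big1 => [|u _]; last by rewrite fharm mul0r.
  rewrite mul0rn => /esym/eqP; rewrite psumr_eq0 => [|u _]; last first.
    by apply: sumr_ge0 => z _; rewrite sqr_ge0.
  move/allP/(_ v (mem_index_enum _)); rewrite /= psumr_eq0 => [|z _]; last first.
    exact: sqr_ge0.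
  move/allP/(_ w (mem_index_enum _)); rewrite evw /= sqrf_eq0 subr_eq0.
  by move/eqP.
move=> v w; have /connectP[p] := econn v w.
elim: p v => [|x p IHp] v /= => [_ ->//|/andP[/edge_eq-> xp] lastw].
exact: IHp.
Qed.

(** A kernel vector f satisfies L f = - c f; its energy is nonnegative, which forces the sum of c
    f^2 to vanish. *)
Lemma lapmx_shift_unit (R : realFieldType) (V : finType) (e : rel V) (c : R) :
  symmetric e -> 0 < c -> lapmx R e + c%:M \in unitmx.
Proof.
move=> e_sym c_gt0; rewrite -row_free_unit -kermx_eq0; apply/rowV0P=> x.
move=> /sub_kermxP; rewrite mulmxDr mul_mx_scalar => x0.
pose f v := x 0 (enum_rank v).
have lapf v : \sum_(w | e v w) (f v - f w) = - (c * f v).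
  rewrite -mulmx_lapmx //; apply/eqP; rewrite -addr_eq0; apply/eqP.
  by have /matrixP/(_ 0 (enum_rank v)) := x0; rewrite !mxE.
have f2 : \sum_v c * f v ^+ 2 = 0.
  apply/eqP; rewrite eq_le [X in _ && X]sumr_ge0; last first.
    by move=> v _; rewrite mulr_ge0 ?sqr_ge0 // ltW.
  rewrite andbT -oppr_ge0 -sumrN.
  have := sum_lap_quadratic R V e f e_sym.
  under eq_bigr => v _ do rewrite lapf mulNr -mulrA -expr2.
  move=> q; rewrite -(pmulrn_lge0 _ (ltn0Sn 1)) q.
  by apply: sumr_ge0 => v _; apply: sumr_ge0 => w _; rewrite sqr_ge0.
apply/matrixP=> i j; rewrite ord1 mxE -[j]enum_valK -/(f _).
move/eqP: f2; rewrite psumr_eq0 => [|v _]; last by rewrite mulr_ge0 ?sqr_ge0 // ltW.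
move/allP/(_ (enum_val j) (mem_index_enum _)) => /=.
by rewrite mulf_eq0 gt_eqF //= sqrf_eq0 => /eqP.
Qed.

(** * Resistances and the Kirchhoff index from a potential kernel *)

(* In matrix form: X L = I - 1 c, with L the Laplacian and c a row vector. *)
Definition potential_kernel (R : nzRingType) (V : finType) (e : rel V)
    (X : V -> V -> R) (c : V -> R) : Prop :=
  forall u v, \sum_(w | e v w) (X u v - X u w) = (u == v)%:R - c v.

(** In the difference of the rows u and v of [X] the term [c] cancels, so this difference [y] is an
    explicit solution of y L = e_u - e_v, to be compared with the solution [x] given by [pinvmx]. *)
Lemma resistance_potential (R : fieldType) (V : finType) (e : rel V)
    (X : V -> V -> R) (c : V -> R) (u v : V) :
  symmetric e -> potential_kernel R V e X c ->
  resistance R e u v = X u u + X v v - X u v - X v u.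
Proof.
move=> e_sym XL; rewrite /resistance; set b := (X in X *m _); set x := b *m _.
pose y : 'rV[R]_#|V| := \row_j (X u (enum_val j) - X v (enum_val j)).
have yL : y *m lapmx R e = b.
  apply/matrixP=> i j; rewrite ord1 -[j]enum_valK mulmx_lapmx //.
  under eq_bigr => w _ do rewrite !mxE !enum_rankK.
  set k := enum_val j.
  transitivity (\sum_(w | e k w) ((X u k - X u w) - (X v k - X v w))).
    by apply: eq_bigr => w _; ring.
  rewrite sumrB !XL !mxE eqxx /= !(inj_eq enum_rank_inj) ![k == _]eq_sym.
  by ring.
have xL : x *m lapmx R e = b by apply: mulmxKpV; rewrite -yL submxMl.
(* As L is symmetric, x b^T = x (y L)^T = x L y^T = b y^T: both solutions give the same potential
   difference. *)
have: x *m b^T = b *m y^T by rewrite -[b in b^T]yL trmx_mul mulmxA tr_lapmx // xL.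
move/matrixP/(_ 0 0).
rewrite mulmxBl -!rowE linearB /= !trmx_delta mulmxBr -!colE !mxE !enum_rankK.
by move=> ->; ring.
Qed.

(** The expression for the resistance is symmetric and vanishes on the diagonal, so twice the index
    is its sum over all ordered pairs. *)
Lemma kirchhoff_potential (R : realFieldType) (V : finType) (e : rel V)
    (X : V -> V -> R) (c : V -> R) :
  symmetric e -> potential_kernel R V e X c ->
  kirchhoff R e = #|V|%:R * \sum_u X u u - \sum_u \sum_v X u v.
Proof.
move=> e_sym XL; rewrite /kirchhoff.
pose r u v := X u u + X v v - X u v - X v u.
under eq_bigr do under eq_bigr do rewrite (resistance_potential _ _ _ _ _ _ _ e_sym XL) -/(r _ _).
set K := (LHS).
have K2 : K + K = \sum_u \sum_v r u v.
  have swap : K = \sum_u \sum_(v | (enum_rank v < enum_rank u)%N) r u v.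
    rewrite /K (exchange_big_dep predT) //=; apply: eq_bigr => u _.
    by apply: eq_bigr => v _; rewrite /r; ring.
  rewrite {2}swap -big_split; apply: eq_bigr => u _ /=.
  rewrite big_mkcond [X in _ + X]big_mkcond -big_split; apply: eq_bigr => v _ /=.
  case: ltngtP => [||/val_inj/enum_rank_inj->]; rewrite ?addr0 ?add0r //.
  by rewrite /r; ring.
have sumr : \sum_u \sum_v r u v =
    (#|V|%:R * \sum_u X u u - \sum_u \sum_v X u v) *+ 2.
  have sumc (a : R) : \sum_(v : V) a = #|V|%:R * a.
    by rewrite sumr_const mulr_natl.
  rewrite /r; under eq_bigr do rewrite !sumrB big_split /= sumc.
  rewrite !sumrB big_split /= sumc -mulr_sumr.
  by rewrite [X in _ - X]exchange_big /=; ring.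
by apply: (@mulIf _ 2%:R); rewrite ?pnatr_eq0 // !mulr_natr -sumr -K2 mulr2n.
Qed.

(** For P the pseudo-inverse of L, all rows of I - P L are equal, and [c] is their common value. *)
Lemma potential_kernel_exists (R : realFieldType) (V : finType) (e : rel V) :
  symmetric e -> connected_graph e ->
  exists X : V -> V -> R, exists c : V -> R, potential_kernel R V e X c.
Proof.
move=> e_sym econn; pose L := lapmx R e; pose P := pinvmx L.
pose X u v := P (enum_rank u) (enum_rank v); exists X.
have PL u v : (P *m L) (enum_rank u) (enum_rank v) = \sum_(w | e v w) (X u v - X u w).
  exact: mulmx_lapmx.
pose d u v := (u == v)%:R - \sum_(w | e v w) (X u v - X u w).
have dE u u' v : d u v = d u' v.
  pose b : 'rV[R]_#|V| := delta_mx 0 (enum_rank u) - delta_mx 0 (enum_rank u').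
  (* The columns of the cokernel of L are harmonic, hence constant, and a difference of two unit
     rows annihilates constants; so it lies in the row space of L. *)
  have bL : (b <= L)%MS.
    rewrite submxE; move: (cokermx L) (mulmx_coker L) => K LK.
    apply/eqP/matrixP=> i j; rewrite mulmxBl -!rowE !mxE.
    apply/eqP; rewrite subr_eq0; apply/eqP.
    pose f w := K (enum_rank w) j; rewrite -!/(f _).
    apply: (harmonic_constant R V e f e_sym econn) => w.
    have := mulmx_lapmx _ _ e _ K^T j w e_sym.
    rewrite -{1}(tr_lapmx _ _ _ e_sym) -trmx_mul LK !mxE => /esym.
    by under eq_bigr do rewrite !mxE.
  have := mulmxKpV bL; rewrite -mulmxA mulmxBl -!rowE -/P => h.
  have {h} := congr1 (fun M : 'rV_#|V| => M 0 (enum_rank v)) h.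
  move: (P *m L) PL => Q QL; rewrite !mxE !QL.
  rewrite eqxx /= !(inj_eq enum_rank_inj) /d ![v == _]eq_sym => h.
  by lra.
(* Without vertices there is no row to read [c] from, and any function will do. *)
have [u0 _|V0] := pickP V; last by exists (fun=> 0) => u; have := V0 u.
by exists (d u0) => u v; rewrite -(dE u) /d; ring.
Qed.

(** * Sums over incident vertices and edges *)

(** The map sending w to {v, w} is a bijection from the neighbours of v to the edges at v; it is
    injective because there are no loops. *)
Lemma sum_incident_edges (R : nmodType) (V : finType) (e : rel V)
    (F : {set V} -> R) (v : V) : simple_graph e ->
  \sum_(E : edge_type e | v \in val E) F (val E) =
    \sum_(w | e v w) F [set v; w].
Proof.
case=> e_sym e_irr.
have nbr_neq w : e v w -> v != w by apply: contraTneq => <-; rewrite e_irr.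
have inj : {in [set w | e v w] &, injective (fun w => [set v; w])}.
  move=> w w'; rewrite !inE => /nbr_neq vw /nbr_neq vw' /setP/(_ w).
  by rewrite !inE eqxx orbT [w == v]eq_sym (negPf vw) => /esym/eqP.
transitivity (\sum_(w in [set w | e v w]) F [set v; w]); last first.
  by apply: eq_bigl => w; rewrite inE.
rewrite -(big_imset _ inj) /=.
transitivity (\sum_(E | is_edge e E && (v \in E)) F E).
  rewrite [RHS](reindex_omap (val : edge_type e -> _) insub) /= => [|E /andP[Ee _]].
    by apply: eq_bigl => E; rewrite valK eqxx (valP E) andbT.
  by rewrite insubT.
apply: eq_bigl => E; apply/andP/imsetP.
  case=> /existsP[x /existsP[y /andP[exy /eqP->]]].
  rewrite !inE => /orP[]/eqP->; first by exists y; rewrite ?inE.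
  by exists x; rewrite ?inE 1?e_sym // setUC.
case=> w; rewrite inE => evw ->; split; last by rewrite !inE eqxx.
by apply/existsP; exists v; apply/existsP; exists w; rewrite evw eqxx.
Qed.

Lemma sum_edge_ends (R : nmodType) (V : finType) (e : rel V) (f : V -> R)
    (v w : V) : simple_graph e -> e v w ->
  \sum_(u in [set v; w]) f u = f v + f w.
Proof.
case=> _ e_irr evw; rewrite big_setU1 ?big_set1 // inE.
by apply: contraTneq evw => ->; rewrite e_irr.
Qed.

Lemma card_edge (V : finType) (e : rel V) (E : edge_type e) :
  simple_graph e -> #|val E| = 2%N.
Proof.
case=> _ e_irr; case: E => E /= /existsP[x /existsP[y /andP[exy /eqP->]]].
by rewrite cards2; case: eqVneq exy => // ->; rewrite e_irr.
Qed.

Lemma sum_incident_const (R : comNzRingType) (V : finType) (e : rel V) (r : nat)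
    (a : R) (v : V) : simple_graph e -> regular e r ->
  \sum_(E : edge_type e | v \in val E) a = r%:R * a.
Proof.
move=> e_simple e_reg; rewrite (sum_incident_edges _ _ _ (fun=> a)) //.
by rewrite sumr_const mulr_natl -(e_reg v) /deg cardsE.
Qed.

(** This is B B^T = r I + A, with B the vertex-edge incidence matrix, applied to [f]. *)
Lemma sum_incident_ends (R : comNzRingType) (V : finType) (e : rel V) (r : nat)
    (f : V -> R) (v : V) : simple_graph e -> regular e r ->
  \sum_(E : edge_type e | v \in val E) \sum_(w in val E) f w =
    r%:R * f v + \sum_(w | e v w) f w.
Proof.
move=> e_simple e_reg.
rewrite (sum_incident_edges _ _ _ (fun E => \sum_(w in E) f w)) //.
under eq_bigr do rewrite (sum_edge_ends _ _ e) //.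
by rewrite big_split sumr_const mulr_natl -(e_reg v) /deg cardsE.
Qed.

Lemma exchange_incident (R : nmodType) (V : finType) (e : rel V)
    (F : edge_type e -> V -> R) :
  \sum_(E : edge_type e) \sum_(v in val E) F E v =
    \sum_v \sum_(E : edge_type e | v \in val E) F E v.
Proof. by rewrite (exchange_big_dep predT). Qed.

Lemma handshake (R : comNzRingType) (V : finType) (e : rel V) (r : nat) :
  simple_graph e -> regular e r ->
  #|V|%:R * r%:R = 2%:R * (num_edges e)%:R :> R.
Proof.
move=> e_simple e_reg.
transitivity (\sum_(E : edge_type e) \sum_(v in val E) (1 : R)).
  rewrite exchange_incident; under eq_bigr do rewrite (sum_incident_const _ _ _ r) //.
  by rewrite sumr_const mulr1 mulr_natl.
under eq_bigr do rewrite sumr_const card_edge //.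
by rewrite sumr_const mulr_natr.
Qed.

(** * Sums over the corona and over the neighbourhoods of its vertices *)

Lemma sum_option (R : nmodType) (T : finType) (F : option T -> R) :
  \sum_a F a = F None + \sum_t F (Some t).
Proof.
rewrite (bigD1 None) //= (reindex_omap Some id) => [|[]//].
by congr (_ + _); apply: eq_bigl => t; rewrite /= eqxx.
Qed.

Lemma sum_ce_vert (R : nmodType) (V1 V2 : finType) (e2 : rel V2)
    (F : ce_vert V1 e2 -> R) :
  \sum_x F x = \sum_i (F (i, None) + (\sum_v F (i, Some (inl v)) +
                                      \sum_E F (i, Some (inr E)))).
Proof.
transitivity (\sum_(i : V1) \sum_a F (i, a)).
  by rewrite pair_bigA; apply: eq_bigr => -[].
apply: eq_bigr => i _ /=.
by rewrite sum_option /= big_sumType.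
Qed.

Section Corona.
Variables (R : comNzRingType) (V1 V2 : finType) (e1 : rel V1) (e2 : rel V2).
Variables (F : ce_vert V1 e2 -> R) (j : V1).

Lemma sum_nbr_root :
  \sum_(x | @corona_edge_sub V1 V2 e1 e2 (j, None) x) F x =
    \sum_(i | e1 j i) F (i, None) + \sum_E F (j, Some (inr E)).
Proof.
rewrite big_mkcond sum_ce_vert /corona_edge_sub /= big_split /=; congr (_ + _).
  by rewrite [RHS]big_mkcond.
rewrite (bigD1 j) //= eqxx big1_eq add0r [X in _ + X]big1 ?addr0 // => i.
by rewrite eq_sym => /negPf ->; rewrite !big1_eq addr0.
Qed.

Lemma sum_nbr_vertex (v : V2) :
  \sum_(x | @corona_edge_sub V1 V2 e1 e2 (j, Some (inl v)) x) F x =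
    \sum_(E : edge_type e2 | v \in val E) F (j, Some (inr E)).
Proof.
rewrite big_mkcond sum_ce_vert /corona_edge_sub /= (bigD1 j) //= eqxx /=.
rewrite big1_eq !add0r [X in _ + X]big1 ?addr0; last first.
  move=> i; rewrite eq_sym => /negPf ->.
  by rewrite !big1_eq !addr0.
by rewrite [RHS]big_mkcond.
Qed.

Lemma sum_nbr_edge (E : edge_type e2) :
  \sum_(x | @corona_edge_sub V1 V2 e1 e2 (j, Some (inr E)) x) F x =
    F (j, None) + \sum_(v in val E) F (j, Some (inl v)).
Proof.
rewrite big_mkcond sum_ce_vert /corona_edge_sub /= (bigD1 j) //= eqxx /=.
rewrite big1_eq addr0 [X in _ + X]big1 ?addr0; last first.
  move=> i; rewrite eq_sym => /negPf ->.
  by rewrite !big1_eq !addr0.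
by rewrite [in RHS]big_mkcond.
Qed.

End Corona.

(** * The grounded kernel of one copy of the subdivision graph *)

(* The inverse of the block of the corona Laplacian indexed by one copy of
   S(G2), when the root is grounded; [g] is the inverse of L + r. *)
Definition grounded_kernel (R : fieldType) (V : finType) (e : rel V)
    (g : V -> V -> R) (a b : option (V + edge_type e)) : R :=
  match a, b with
  | Some (inl v), Some (inl w) => 3 * g v w
  | Some (inl v), Some (inr E) => \sum_(w in val E) g v w
  | Some (inr E), Some (inl w) => \sum_(v in val E) g v w
  | Some (inr E), Some (inr E') =>
      ((E == E')%:R + \sum_(v in val E) \sum_(w in val E') g v w) / 3
  | _, _ => 0
  end.

Section GroundedKernel.
Variables (R : realFieldType) (V : finType) (e : rel V) (r : nat).
Hypotheses (e_simple : simple_graph e) (e_reg : regular e r) (r_gt0 : (0 < r)%N).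
Variable g : V -> V -> R.
Hypothesis gE : forall v w,
  r%:R * g v w + \sum_(u | e w u) (g v w - g v u) = (v == w)%:R.

Notation M := (grounded_kernel R V e g).

Let r_neq0 : r%:R != 0 :> R.
Proof. by rewrite pnatr_eq0 -lt0n. Qed.

(** By regularity L + r = 2 r - A, so g (L + r) = I reads g A = 2 r g - I. *)
Lemma sum_neighbors v w :
  \sum_(u | e w u) g v u = 2 * r%:R * g v w - (v == w)%:R.
Proof.
by rewrite -gE sumrB sumr_const -mulr_natl -(e_reg w) /deg cardsE; ring.
Qed.

(** Since A 1 = r 1, summing a row of g A = 2 r g - I gives r s = 2 r s - 1 for the row sum s of
    [g]. *)
Lemma sum_shifted_inverse v : \sum_w g v w = r%:R^-1.
Proof.
have nbrs : \sum_w \sum_(u | e w u) g v u = r%:R * \sum_w g v w.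
  rewrite (exchange_big_dep predT) //= mulr_sumr; apply: eq_bigr => w _.
  rewrite (eq_bigl (e w)) => [|u]; last by case: e_simple => ->.
  by rewrite sumr_const mulr_natl -(e_reg w) /deg cardsE.
have : \sum_w \sum_(u | e w u) g v u = 2 * r%:R * (\sum_w g v w) - 1.
  under eq_bigr do rewrite sum_neighbors.
  rewrite sumrB -mulr_sumr [X in _ - X](bigD1 v) //= eqxx [X in _ - (_ + X)]big1 ?addr0 // => w.
  by rewrite eq_sym => /negPf ->.
rewrite nbrs => h; apply: (mulfI r_neq0); rewrite divff //; lra.
Qed.

Lemma sum_shifted_inverse_ends (E : edge_type e) :
  \sum_w \sum_(v in val E) g v w = 2 / r%:R.
Proof.
rewrite exchange_big /=; under eq_bigr do rewrite sum_shifted_inverse.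
by rewrite sumr_const (card_edge _ _ _ e_simple) mulr_natl.
Qed.

(** Only subdivision vertices are joined to the root, which is at potential 0, so the sum is the
    current flowing into the root. A unit current injected at a non-root vertex leaves entirely
    there. *)
Lemma grounded_kernel_current a :
  \sum_E M a (Some (inr E)) = (if a is Some _ then 1 else 0).
Proof.
case: a => [[v|E]|] /=; last by rewrite big1.
  rewrite exchange_incident.
  under eq_bigr do rewrite (sum_incident_const _ _ _ r) //.
  by rewrite -mulr_sumr sum_shifted_inverse divff.
rewrite -mulr_suml big_split /= (bigD1 E) //= eqxx big1 ?addr0; last first.
  by move=> E'; rewrite eq_sym => /negPf ->.
rewrite exchange_big /=; under eq_bigr do rewrite exchange_incident.
under eq_bigr do under eq_bigr do rewrite (sum_incident_const _ _ _ r) //.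
under eq_bigr do rewrite -mulr_sumr sum_shifted_inverse divff //.
rewrite sumr_const (card_edge _ _ _ e_simple).
by field.
Qed.

(** The grounded block is r I on vertices, 3 I on edges, and - B off the diagonal. The Schur
    complement of the edge part is r I - B B^T / 3 = (L + r) / 3, whose inverse is 3 g; the other
    blocks of the inverse are g B, its transpose and (I + B^T g B) / 3. This lemma checks the
    columns of vertices. *)
Lemma grounded_kernel_vertex a w :
  \sum_(E : edge_type e | w \in val E) (M a (Some (inl w)) - M a (Some (inr E))) =
    (a == Some (inl w))%:R.
Proof.
rewrite sumrB (sum_incident_const _ _ _ r) //.
case: a => [[v|E]|] /=.
- rewrite (sum_incident_ends _ _ _ r) // sum_neighbors.
  rewrite -[_ == _]/(v == w); ring.
- rewrite -mulr_suml big_split /= exchange_big /=.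
  under [X in (_ + X) / _]eq_bigr do rewrite (sum_incident_ends _ _ _ r) // sum_neighbors.
  have -> : \sum_(E' : edge_type e | w \in val E') (E == E')%:R = (w \in val E)%:R :> R.
    rewrite big_mkcond (bigD1 E) //= eqxx big1 ?addr0; first by case: ifP.
    by move=> E'; rewrite eq_sym => /negPf ->; rewrite if_same.
  under [X in (_ + X) / _]eq_bigr do rewrite addrA -mulrDl.
  rewrite sumrB -mulr_sumr.
  have -> : \sum_(v in val E) (v == w)%:R = (w \in val E)%:R :> R.
    rewrite big_mkcond (bigD1 w) //= eqxx big1 ?addr0; first by case: ifP.
    by move=> v /negPf ->; rewrite if_same.
  by field.
- by rewrite mulr0 big1 // subr0.
Qed.

(** The columns of edges. The first term belongs to the edge towards the root, so each subdivision
    vertex has degree 3. *)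
Lemma grounded_kernel_edge a E :
  M a (Some (inr E)) + \sum_(w in val E) (M a (Some (inr E)) - M a (Some (inl w))) =
    (a == Some (inr E))%:R.
Proof.
rewrite sumrB sumr_const (card_edge _ _ _ e_simple).
case: a => [[v|E']|] /=.
- by rewrite -mulr_sumr; ring.
- by rewrite [X in _ - X]exchange_big -[RHS]/(E' == E)%:R /=; field.
- by rewrite mul0rn big1_eq subrr addr0.
Qed.

(** The edge part uses tr (B^T g B) = tr (g B B^T) with B B^T = r I + A. *)
Lemma tr_grounded_kernel :
  \sum_a M a a = 3 * (\sum_v g v v) +
    ((num_edges e)%:R +
     \sum_v (r%:R * g v v + \sum_(w | e v w) g v w)) / 3.
Proof.
rewrite sum_option add0r big_sumType /= -mulr_sumr -mulr_suml big_split /=.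
congr (_ + (_ + _) / 3); first by under eq_bigr do rewrite eqxx; rewrite sumr_const.
rewrite exchange_incident; apply: eq_bigr => v _.
by rewrite (sum_incident_ends _ _ _ r).
Qed.

Lemma sum_grounded_kernel :
  \sum_a \sum_b M a b = #|V|%:R * (3 / r%:R + 1) + (num_edges e)%:R * (2 / r%:R + 1).
Proof.
have row_sum a : \sum_b M a b =
    \sum_v M a (Some (inl v)) + \sum_E M a (Some (inr E)).
  by rewrite sum_option big_sumType; case: a => [[]|] *; rewrite add0r.
under eq_bigr do rewrite row_sum grounded_kernel_current.
rewrite sum_option big1 // !add0r big_sumType /=; congr (_ + _).
  under eq_bigr do rewrite -mulr_sumr sum_shifted_inverse.
  by rewrite sumr_const mulr_natl.
under eq_bigr do rewrite sum_shifted_inverse_ends.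
by rewrite sumr_const -[LHS]mulr_natl.
Qed.

(** [X] does not see the position inside a copy, so away from the roots it cancels and the inverse
    of the grounded block remains. At a root, the equation for [X] is corrected by the current
    arriving from the copy: this removes the 1 on the diagonal unless the source is the root
    itself. *)
Lemma corona_potential_kernel (V1 : finType) (e1 : rel V1)
    (X : V1 -> V1 -> R) (c : V1 -> R) : potential_kernel R V1 e1 X c ->
  potential_kernel R _ (@corona_edge_sub V1 V e1 e)
    (fun x y => X x.1 y.1 + (x.1 == y.1)%:R * M x.2 y.2)
    (fun y => if y.2 is None then c y.1 else 0).
Proof.
have M0 a : M a None = 0 by case: a => [[]|].
move=> XL [i a] [j [[v|E]|]] /=; rewrite xpair_eqE.
- rewrite sum_nbr_vertex /= subr0.
  under eq_bigr do rewrite opprD addrACA subrr add0r -mulrBr.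
  by rewrite -mulr_sumr grounded_kernel_vertex mulr_natl mulrb; case: eqP.
- rewrite sum_nbr_edge /= M0 mulr0 subr0 addr0.
  under eq_bigr do rewrite opprD addrACA subrr add0r -mulrBr.
  rewrite [X in X - _]addrC addrK.
  rewrite -mulr_sumr -mulrDr grounded_kernel_edge mulr_natl mulrb.
  by case: eqP.
rewrite sum_nbr_root /= M0 mulr0 addr0.
under eq_bigr do rewrite mulr0 addr0.
rewrite XL; under eq_bigr do rewrite opprD addrA subrr sub0r.
rewrite sumrN -mulr_sumr grounded_kernel_current.
case: a => [a|]; rewrite ?andbT ?andbF /=; last by rewrite mulr0 subr0.
by rewrite mulr1; ring.
Qed.

End GroundedKernel.

(** * The Kirchhoff index of the corona *)

(** Here [k] counts the vertices of a copy together with its root. The corona kernel has trace k tr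
    X + n1 tr M and entry sum k^2 sum X + n1 sum M, on n1 k vertices; the terms in [X] assemble to
    k^2 times the index of the first graph. *)
Lemma kirchhoff_corona (R : realFieldType) (V1 V2 : finType) (e1 : rel V1)
    (e2 : rel V2) (r : nat) (g : V2 -> V2 -> R) :
  simple_graph e1 -> connected_graph e1 ->
  simple_graph e2 -> regular e2 r -> (0 < r)%N ->
  (forall v w, r%:R * g v w + \sum_(u | e2 w u) (g v w - g v u) = (v == w)%:R) ->
  let k : R := 1 + #|V2|%:R + (num_edges e2)%:R in
  kirchhoff R (@corona_edge_sub V1 V2 e1 e2) =
    k ^+ 2 * kirchhoff R e1 +
    #|V1|%:R ^+ 2 * k * (\sum_a grounded_kernel R V2 e2 g a a) -
    #|V1|%:R * (\sum_a \sum_b grounded_kernel R V2 e2 g a b).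
Proof.
move=> [e1_sym _] e1_conn e2_simple e2_reg r_gt0 gE k.
have [X [c XL]] := potential_kernel_exists R V1 e1 e1_sym e1_conn.
have corona_sym : symmetric (@corona_edge_sub V1 V2 e1 e2).
  by move=> [i [[v|E]|]] [j [[w|E']|]]; rewrite /corona_edge_sub /= ?[j == i]eq_sym.
have XM := corona_potential_kernel R V2 e2 r e2_simple e2_reg r_gt0 g gE V1 e1 X c XL.
rewrite (kirchhoff_potential R _ _ _ _ corona_sym XM).
rewrite (kirchhoff_potential R _ _ _ _ e1_sym XL).
set A := option (V2 + edge_type e2).
have cardA : #|{: A}|%:R = k.
  by rewrite card_option card_sum -natr1 natrD addrC addrA.
have cardV : #|ce_vert V1 e2|%:R = #|V1|%:R * k.
  by rewrite card_prod natrM -cardA.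
have sumA (a : R) : \sum_(b : A) a = k * a by rewrite sumr_const -cardA mulr_natl.
have sumV1 (a : R) : \sum_(i : V1) a = #|V1|%:R * a by rewrite sumr_const mulr_natl.
have pairE (F : V1 -> A -> R) : \sum_(x : ce_vert V1 e2) F x.1 x.2 = \sum_i \sum_a F i a.
  by rewrite pair_bigA.
set M := grounded_kernel R V2 e2 g.
have trE : \sum_(x : ce_vert V1 e2) (X x.1 x.1 + (x.1 == x.1)%:R * M x.2 x.2) =
    k * (\sum_i X i i) + #|V1|%:R * \sum_a M a a.
  rewrite (pairE (fun i a => X i i + (i == i)%:R * M a a)).
  under eq_bigr do (under eq_bigr do rewrite eqxx mul1r; rewrite big_split /= sumA).
  by rewrite big_split /= -mulr_sumr sumV1.
have sumE : \sum_(x : ce_vert V1 e2) \sum_(y : ce_vert V1 e2)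
      (X x.1 y.1 + (x.1 == y.1)%:R * M x.2 y.2) =
    k ^+ 2 * (\sum_i \sum_j X i j) + #|V1|%:R * \sum_a \sum_b M a b.
  rewrite (pairE (fun i a => \sum_(y : ce_vert V1 e2) (X i y.1 + (i == y.1)%:R * M a y.2))).
  have inner i a : \sum_(y : ce_vert V1 e2) (X i y.1 + (i == y.1)%:R * M a y.2) =
      k * (\sum_j X i j) + \sum_b M a b.
    rewrite (pairE (fun j b => X i j + (i == j)%:R * M a b)).
    under eq_bigr do rewrite big_split /= sumA -mulr_sumr.
    rewrite big_split /= -mulr_sumr; congr (_ + _).
    rewrite (bigD1 i) //= eqxx mul1r [X in _ + X]big1 ?addr0 // => j.
    by rewrite eq_sym => /negPf ->; rewrite mul0r.
  under eq_bigr do (under eq_bigr do rewrite inner; rewrite big_split /= sumA).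
  by rewrite big_split /= sumV1 -!mulr_sumr mulrA expr2.
by rewrite trE sumE cardV; ring.
Qed.

Theorem theorem4p3 (R : rcfType) (V1 V2 : finType) (e1 : rel V1) (e2 : rel V2)
    (r2 : nat) (mu : 'I_#|V2| -> R) :
  simple_graph e1 -> connected_graph e1 ->
  simple_graph e2 -> regular e2 r2 -> (1 <= r2)%N ->
  char_poly (lapmx R e2) = \prod_(i < #|V2|) ('X - (mu i)%:P) ->
  let n1 : R := #|V1|%:R in
  let n2 : R := #|V2|%:R in
  let m2 : R := (num_edges e2)%:R in
  let r : R := r2%:R in
  let C : 'M[R]_#|V2| := lapmx R e2 + r%:M in
  let S : R := \sum_(i < #|V2|) 1 / (mu i + r) in
  kirchhoff R (@corona_edge_sub V1 V2 e1 e2) =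
    n1 * (1 + n2 + m2) *
      (n1 * m2 / 3
       + n1 / 3 * (\tr (invmx C *m adjmx R e2) + r * S)
       + 3 * n1 * S
       + (m2 + n2 + 1) / n1 * kirchhoff R e1)
    - (n1 * m2 * r + n1 * n2 * (r + 3) ^+ 2) / (3 * r).
Proof.
move=> e1_simple e1_conn e2_simple e2_reg r2_gt0 chL n1 n2 m2 r C S.
have [e2_sym _] := e2_simple.
have r_gt0 : 0 < r by rewrite ltr0n.
have unitC : C \in unitmx by apply: lapmx_shift_unit.
pose g v w := invmx C (enum_rank v) (enum_rank w).
have gE v w : r * g v w + \sum_(u | e2 w u) (g v w - g v u) = (v == w)%:R.
  rewrite -mulmx_lapmx // addrC -(inj_eq enum_rank_inj).
  have := congr1 (fun B : 'M_#|V2| => B (enum_rank v) (enum_rank w)) (mulVmx unitC).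
  by rewrite mulmxDr mul_mx_scalar /= => h; rewrite [in LHS]/g; move: h; rewrite !mxE.
have trS : \sum_v g v v = S.
  by rewrite /S -(tr_invmx_shift _ _ _ _ _ chL unitC) /mxtrace sum_ord_rank.
have trA : \sum_v \sum_(w | e2 v w) g v w = \tr (invmx C *m adjmx R e2).
  rewrite /mxtrace sum_ord_rank; apply: eq_bigr => v _.
  rewrite mxE sum_ord_rank big_mkcond; apply: eq_bigr => w _.
  by rewrite !mxE !enum_rankK e2_sym; case: ifP; rewrite ?mulr1 ?mulr0.
rewrite (kirchhoff_corona R V1 V2 e1 e2 r2 g) //.
rewrite (tr_grounded_kernel R V2 e2 r2) // (sum_grounded_kernel R V2 e2 r2) //.
rewrite big_split /= -mulr_sumr trS trA -/n1 -/n2 -/m2 -/r.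
have hs : n2 * r = 2 * m2 by apply: handshake.
(* Eliminating the number of edges turns the claim into an identity of rational functions. *)
have m2E : m2 = n2 * r / 2 by rewrite hs; field.
(* The empty graph counts as connected, and for it the formula divides by [n1] = 0; both sides are
   then 0. *)
have [V1_0|n1_neq0] := eqVneq n1 0.
  have K0 : kirchhoff R e1 = 0.
    rewrite /kirchhoff big1 // => u _; move/eqP: V1_0.
    by rewrite pnatr_eq0 => /eqP/card0_eq/(_ u).
  by rewrite K0 V1_0; ring.
rewrite m2E; field.
by rewrite n1_neq0 lt0r_neq0.
Qed.
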